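(* Multistage 2-SAT admits a linear-time computable problem kernelization of size $O(n^2\tau)$ and of size $O(m\cdot\tau)$.
   Context: A 2-CNF formula is a conjunction of clauses, each a disjunction of at most two literals (variables or negated variables). Multistage 2-SAT: the input is a set $X$ of variables, a sequence $\Phi=(\phi_1,\dots,\phi_\tau)$, $\tau\ge 1$, of 2-CNF formulas (the ''stages'') over literals over $X$, and an integer $d\ge 0$. The question is whether there are $\tau$ truth assignments $f_1,\dots,f_\tau\colon X\to\{\bot,\top\}$ such that (i) for each $i\in\{1,\dots,\tau\}$, $f_i$ satisfies $\phi_i$, and (ii) for each $i\in\{1,\dots,\tau-1\}$, $|\{x\in X\mid f_i(x)\ne f_{i+1}(x)\}|\le d$. Here $n=|X|$ is the number of variables and $m$ is the maximum number of clauses in any stage. A problem kernelization for a parameterized problem $L$ is a polynomial-time map sending each instance $(x,p)$ to an equivalent instance $(x',p')$ of $L$ (the problem kernel) with $|x'|+p'$ bounded by a computable function of the parameter $p$; that bound is its size. As is customary, sizes here are measured by the number of variables and clause occurrences (constant-size units for variables and literals). *)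

(* Defs.v *)
From mathcomp Require Import all_boot.

Set Implicit Arguments.
Unset Strict Implicit.
Unset Printing Implicit Defensive.

(* The variable set is X = 'I_n.  A literal is a variable with its sign, [true]
   for the positive literal; a clause is a list because it may repeat a literal,
   and a formula is a list because it may repeat a clause. *)
Definition literal (n : nat) : Type := ('I_n * bool)%type.
Definition clause (n : nat) : Type := 2.-bseq (literal n).
Definition formula (n : nat) : Type := seq (clause n).
Definition assignment (n : nat) : Type := {ffun 'I_n -> bool}.

Definition sat_clause (n : nat) (f : assignment n) (c : clause n) : bool :=
  has (fun l : literal n => f l.1 == l.2) c.

Definition sat_formula (n : nat) (f : assignment n) (phi : formula n) : bool :=
  all (sat_clause f) phi.

Record instance : Type := Instance {
  nvars : nat;
  tau : nat;
  stages : tau.-tuple (formula nvars);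
  dist : nat;
  tau_gt0 : 0 < tau
}.

Definition solvable (I : instance) : Prop :=
  exists f : 'I_(tau I) -> assignment (nvars I),
    (forall i, sat_formula (f i) (tnth (stages I) i)) /\
    (forall i j : 'I_(tau I), j = i.+1 :> nat ->
       #|[set x | f i x != f j x]| <= dist I).

Definition max_clauses (I : instance) : nat :=
  \max_(i < tau I) size (tnth (stages I) i).

(* The summand [tau I] accounts for the sequence of stages itself, so that an
   empty stage still occupies one unit of input. *)
Definition inst_size (I : instance) : nat :=
  nvars I + tau I + \sum_(i < tau I) size (tnth (stages I) i).

(* Every list is preceded by its length, so this is a prefix code. *)
Definition encode_clause (n : nat) (c : clause n) : seq nat :=
  size c :: flatten [seq [:: val l.1; nat_of_bool l.2] | l : literal n <- c].

Definition encode_formula (n : nat) (phi : formula n) : seq nat :=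
  size phi :: flatten [seq encode_clause c | c <- phi].

Definition encode (I : instance) : seq nat :=
  [:: nvars I; tau I; dist I] ++
  flatten [seq encode_formula phi | phi <- stages I].

(* Unit-cost RAM with addition, truncated subtraction and indirect addressing,
   presented as a structured language.  There is no unit-cost multiplication,
   which would make the model unreasonably strong.  Memory is split into banks:
   [s b a] is the word at address [a] of bank [b].  A program names only
   finitely many banks, so interleaving them in a single memory costs a constant
   factor.  Scalar variables are cells at constant addresses. *)
Definition memory : Type := nat -> nat -> nat.

Inductive expr : Type :=
| Const of nat
| Read of nat & expr
| Add of expr & expr
| Sub of expr & expr.

Fixpoint eval (s : memory) (e : expr) : nat :=
  match e with
  | Const k => k
  | Read b e1 => s b (eval s e1)
  | Add e1 e2 => eval s e1 + eval s e2
  | Sub e1 e2 => eval s e1 - eval s e2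
  end.

Definition update (s : memory) (b a v : nat) : memory :=
  fun b' a' => if (b' == b) && (a' == a) then v else s b' a'.

Inductive prog : Type :=
| Skip
| Write of nat & expr & expr
| Seq of prog & prog
| If of expr & prog & prog
| While of expr & prog.

(* [exec p s t s']: started in memory s, p halts in memory s' after t steps.
   Evaluating an expression counts as part of one step: the expressions of a
   fixed program have bounded size, so this only affects constant factors. *)
Inductive exec : prog -> memory -> nat -> memory -> Prop :=
| ExecSkip s : exec Skip s 1 s
| ExecWrite s b ea ev :
    exec (Write b ea ev) s 1 (update s b (eval s ea) (eval s ev))
| ExecSeq p q s s1 s2 t1 t2 :
    exec p s t1 s1 -> exec q s1 t2 s2 -> exec (Seq p q) s (t1 + t2) s2
| ExecIfTrue e p q s s1 t :
    eval s e != 0 -> exec p s t s1 -> exec (If e p q) s t.+1 s1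
| ExecIfFalse e p q s s1 t :
    eval s e = 0 -> exec q s t s1 -> exec (If e p q) s t.+1 s1
| ExecWhileTrue e p s s1 s2 t1 t2 :
    eval s e != 0 -> exec p s t1 s1 -> exec (While e p) s1 t2 s2 ->
    exec (While e p) s (t1 + t2).+1 s2
| ExecWhileFalse e p s : eval s e = 0 -> exec (While e p) s 1 s.

(* Bank 0 initially holds the input and bank 1 finally holds the output, both
   padded with zeros; all other cells are initially zero. *)
Definition input_memory (w : seq nat) : memory :=
  fun b a => if b == 0 then nth 0 w a else 0.

Definition linear_time_computable (K : instance -> instance) : Prop :=
  exists (p : prog) (C : nat), forall I : instance,
    exists (t : nat) (s : memory),
      [/\ exec p (input_memory (encode I)) t s,
          t <= C * inst_size I
        & forall a, s 1 a = nth 0 (encode (K I)) a].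

(* K is a kernelization of Multistage 2-SAT parameterized by q + tau (q being
   nvars or max_clauses), with |x'| + p' in O(g(q, tau)).  The successor in the
   bound is the additive constant needed when g vanishes: for n = 0 or m = 0 no
   instance, having tau > 0, has size 0. *)
Definition kernelization_of_size (q : instance -> nat) (g : nat -> nat -> nat)
    (K : instance -> instance) : Prop :=
  (forall I, solvable (K I) <-> solvable I) /\
  exists C : nat, forall I : instance,
    inst_size (K I) + (q (K I) + tau (K I)) <= C * (g (q I) (tau I)).+1.

(* Main.v *)
(* One kernel serves both bounds: in every stage keep only the first copy of
   each clause, and delete the variables that occur in no clause, naming the
   others by order of first occurrence.  Distinct clauses number O(n^2) per
   stage, and at most 2 m tau variables occur.  If no variable occurs, every
   clause is empty and all stages collapse to a single one.
   In linear time, a clause is coded by a number below (2n+1)^2, and a table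
   indexed by codes holds the last stage in which each clause was seen; stamping
   by stage spares resetting the table.  A table of the multiples of 2n+1,
   built by repeated addition, replaces multiplication. *)
Require Import Defs.
From mathcomp Require Import all_boot.
From mathcomp Require Import zify.

Set Implicit Arguments.
Unset Strict Implicit.
Unset Printing Implicit Defensive.

Arguments update _ _ _ _ _ _ /.

(** * Hoare triples with a time bound *)

(** Total correctness with a time bound, from one given memory instead of a precondition:
    assignments are then executed symbolically. *)
Definition hoare (p : prog) (s : memory) (T : nat) (Q : memory -> Prop) :=
  exists t s', [/\ exec p s t s', t <= T & Q s'].

Fixpoint writes (p : prog) : seq nat :=
  match p with
  | Skip => [::]
  | Write b _ _ => [:: b]
  | Seq p q | If _ p q => writes p ++ writes q
  | While _ p => writes p
  end.

Lemma exec_frame p s t s' b :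
  exec p s t s' -> b \notin writes p -> s' b =1 s b.
Proof.
move=> H; elim: H => //=.
- by move=> s0 b0 ea ev; rewrite inE => /negbTE nb a /=; rewrite nb.
- move=> p1 q s0 s1 s2 t1 t2 _ IH1 _ IH2; rewrite mem_cat negb_or.
  by case/andP=> /IH1 H1 /IH2 H2 a; rewrite H2 H1.
- by move=> e p1 q s0 s1 t0 _ _ IH; rewrite mem_cat negb_or => /andP[/IH].
- by move=> e p1 q s0 s1 t0 _ _ IH; rewrite mem_cat negb_or => /andP[_ /IH].
- by move=> e p0 s0 s1 s2 t1 t2 _ _ IH1 _ IH2 nb a; rewrite IH2 // IH1.
Qed.

(** Lets a postcondition assume that the banks never written by [p] are unchanged. *)
Lemma hoare_frame p s T Q :
  hoare p s T (fun s' => (forall b, b \notin writes p -> s' b =1 s b) -> Q s') ->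
  hoare p s T Q.
Proof.
case=> t [s' [H1 H2 H3]]; exists t, s'; split=> //; apply: H3 => b.
exact: exec_frame H1.
Qed.

Lemma hoare_weaken p s T T' (Q Q' : memory -> Prop) :
  hoare p s T Q -> T <= T' -> (forall s', Q s' -> Q' s') -> hoare p s T' Q'.
Proof.
case=> t [s' [H1 H2 H3]] leT QQ; exists t, s'; split=> //; last exact: QQ.
exact: leq_trans leT.
Qed.

Lemma hoare_skip s T (Q : memory -> Prop) : 0 < T -> Q s -> hoare Skip s T Q.
Proof. by move=> T0 Qs; exists 1, s; split=> //; constructor. Qed.

Lemma hoare_write b ea ev s T (Q : memory -> Prop) :
  0 < T -> Q (update s b (eval s ea) (eval s ev)) -> hoare (Write b ea ev) s T Q.
Proof. by move=> T0 Qs; eexists 1, _; split; [constructor | | exact: Qs]. Qed.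

Lemma hoare_seq p q s T1 T2 Q1 Q :
  hoare p s T1 Q1 -> (forall s', Q1 s' -> hoare q s' T2 Q) ->
  hoare (Seq p q) s (T1 + T2) Q.
Proof.
case=> t1 [s1 [H1 le1 /[swap] /[apply]]] [t2 [s2 [H2 le2 Q2]]].
by exists (t1 + t2), s2; split=> //; [exact: ExecSeq H1 H2 | exact: leq_add].
Qed.

Lemma hoare_write_seq b ea ev q s T Q :
  hoare q (update s b (eval s ea) (eval s ev)) T Q ->
  hoare (Seq (Write b ea ev) q) s T.+1 Q.
Proof.
move=> H; rewrite -add1n.
apply: (@hoare_seq _ _ _ _ _ (fun s' => s' = update s b (eval s ea) (eval s ev))).
  exact: hoare_write.
by move=> _ ->.
Qed.

Lemma hoare_if e p q s T Q :
  (eval s e != 0 -> hoare p s T Q) -> (eval s e = 0 -> hoare q s T Q) ->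
  hoare (If e p q) s T.+1 Q.
Proof.
case: (eqVneq (eval s e) 0) => e0 Hp Hq.
  have [t [s' [H1 H2 H3]]] := Hq e0; exists t.+1, s'; split=> //.
  exact: ExecIfFalse.
have [t [s' [H1 H2 H3]]] := Hp isT; exists t.+1, s'; split=> //.
exact: ExecIfTrue.
Qed.

(** The invariant speaks of the items treated and the items left. Each iteration moves one item
    across, so induction on the items left gives both termination and cost. *)
Lemma hoare_while X e p (f : X -> nat) (I : seq X -> seq X -> memory -> Prop) :
  (forall d x r s, I d (x :: r) s ->
     eval s e != 0 /\ hoare p s (f x) (I (rcons d x) r)) ->
  (forall d s, I d [::] s -> eval s e = 0) ->
  forall r d s, I d r s ->
    hoare (While e p) s (\sum_(x <- r) (f x).+1).+1 (I (d ++ r) [::]).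
Proof.
move=> Hstep Hend; elim=> [|x r IH] d s Is.
  exists 1, s; split=> //; last by rewrite cats0.
  by apply: ExecWhileFalse; exact: Hend Is.
have [e0 [t1 [s1 [H1 le1 I1]]]] := Hstep _ _ _ _ Is.
have [t2 [s2 [H2 le2 I2]]] := IH _ _ I1.
exists (t1 + t2).+1, s2; split; first exact: ExecWhileTrue H1 H2.
  by rewrite big_cons; lia.
by rewrite -cat_rcons.
Qed.

(** * First occurrences in a list *)

Section FirstOccurrence.
Variable T : eqType.
Implicit Types (s : seq T) (x : T).

(** [undup] keeps last occurrences; reversing twice keeps the first ones, so the list grows at its
    end as in a left-to-right scan. *)
Definition fdup s := rev (undup (rev s)).

Lemma fdup_rcons s x :
  fdup (rcons s x) = if x \in s then fdup s else rcons (fdup s) x.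
Proof. by rewrite /fdup rev_rcons /= mem_rev; case: ifP => //; rewrite rev_cons. Qed.

Lemma mem_fdup s : fdup s =i s.
Proof. by move=> x; rewrite mem_rev mem_undup mem_rev. Qed.

Lemma fdup_uniq s : uniq (fdup s).
Proof. by rewrite rev_uniq undup_uniq. Qed.

Lemma size_fdup s : size (fdup s) <= size s.
Proof. by rewrite size_rev (leq_trans (size_undup _)) // size_rev. Qed.

Lemma fdup_cat s1 s2 :
  fdup (s1 ++ s2) = fdup s1 ++ [seq x <- fdup s2 | x \notin s1].
Proof.
rewrite /fdup rev_cat undup_cat rev_cat filter_rev; congr (_ ++ rev _).
by apply: eq_filter => x; rewrite mem_rev.
Qed.

(** A new element gets its final index as soon as it is met, so one pass suffices to rename. *)
Lemma index_fdup s1 x s2 : x \notin s1 ->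
  index x (fdup (s1 ++ x :: s2)) = size (fdup s1).
Proof.
move=> xs1; rewrite -cat_rcons fdup_cat fdup_rcons (negbTE xs1).
rewrite index_cat mem_rcons mem_head -cats1 index_cat mem_fdup (negbTE xs1).
by rewrite /= eqxx addn0.
Qed.

End FirstOccurrence.

(* Reading a clause as a number in base [2n + 1] with nonzero digits. *)
Definition digit n (l : literal n) := (val l.1 + val l.1 + l.2).+1.

Definition code n (c : seq (literal n)) :=
  foldl (fun a l => a * (n + n + 1) + digit l) 0 c.

Lemma digit_bound n (l : literal n) : digit l < n + n + 1.
Proof. by case: l => x []; rewrite /digit /=; have := ltn_ord x; lia. Qed.

Lemma digit_inj n : injective (@digit n).
Proof.
move=> [x b] [y c]; rewrite /digit /= => H.
have [xy bc] : val x = val y /\ b = c by case: b c H => [] [] /=; lia.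
by congr pair => //; apply: val_inj.
Qed.

Lemma code_bound n (c : clause n) : code c < (n + n + 1) ^ 2.
Proof.
case: c => [[|l [|l' []]]] //= _; rewrite /code /= ?mul0n ?add0n; first by lia.
  by have := digit_bound l; lia.
have := digit_bound l; have := digit_bound l'; rewrite expnS expn1; nia.
Qed.

(** Digits lie below the base, so the last one can be split off ([D]); they are nonzero, so clauses
    of different lengths get different codes ([D0]). *)
Lemma code_inj n : injective (fun c : clause n => code c).
Proof.
have D (a b : nat) (l1 l2 : literal n) :
    a * (n + n + 1) + digit l1 = b * (n + n + 1) + digit l2 -> a = b /\ l1 = l2.
  have H1 := digit_bound l1; have H2 := digit_bound l2 => E.
  have ab : a = b by nia.
  by split=> //; apply: digit_inj; subst b; lia.
have D0 (a : nat) (l1 : literal n) : a * (n + n + 1) + digit l1 <> 0.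
  by rewrite /digit; lia.
move=> [c Hc] [c' Hc'] E; apply: val_inj => /=; move: E; rewrite /code /=.
case: c Hc => [|l [|l' []]] //= _; case: c' Hc' => [|k [|k' []]] //= _.
all: try by move=> H; case: (D0 _ _ H).
all: try by move=> H; case: (D0 _ _ (esym H)).
- by case/D=> _ ->.
- by case/D=> H; case: (D0 _ _ (esym H)).
- by case/D=> H; case: (D0 _ _ H).
- by case/D=> /D[_ ->] ->.
Qed.

(** * The kernel *)

Definition vars_clause n (c : seq (literal n)) : seq 'I_n := [seq l.1 | l <- c].
Definition vars_formula n (phi : formula n) : seq 'I_n :=
  flatten [seq vars_clause c | c : clause n <- phi].
Definition vars_stages n (S : seq (formula n)) : seq 'I_n :=
  flatten [seq vars_formula phi | phi <- S].

Definition used (I : instance) : seq 'I_(nvars I) := fdup (vars_stages (stages I)).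

Definition rename n n' (g : 'I_n -> 'I_n') (c : clause n) : clause n' :=
  map_bseq (fun l : literal n => (g l.1, l.2)) c.

(** If no variable occurs, every clause is empty; the boolean count in [nseq] yields one empty
    clause exactly when the input has a clause. Otherwise the form [.-1.+1] provides the successor
    that [inord] needs. *)
Definition kernel (I : instance) : instance :=
  if used I is [::] then
    @Instance 0 1 [tuple nseq (0 < size (flatten (stages I))) [bseq]] (dist I)
      (ltn0Sn 0)
  else
    @Instance (size (used I)).-1.+1 (tau I)
      (map_tuple (fun phi => [seq rename (fun x => inord (index x (used I))) c
                               | c <- fdup phi]) (stages I))
      (dist I) (tau_gt0 I).

Lemma vars_clause_sub n (c : clause n) (phi : formula n) :
  c \in phi -> {subset vars_clause c <= vars_formula phi}.
Proof. by move=> cphi x xc; apply/flatten_mapP; exists c. Qed.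

Lemma vars_formula_sub n (phi : formula n) (S : seq (formula n)) :
  phi \in S -> {subset vars_formula phi <= vars_stages S}.
Proof. by move=> phiS x xphi; apply/flatten_mapP; exists phi. Qed.

Lemma size_vars_formula n (phi : formula n) : size (vars_formula phi) <= 2 * size phi.
Proof.
elim: phi => [|c phi IH] //=.
by rewrite /vars_formula /= size_cat size_map mulnS leq_add // size_bseq.
Qed.

Lemma size_vars_stages n (S : seq (formula n)) :
  size (vars_stages S) <= 2 * \sum_(phi <- S) size phi.
Proof.
elim: S => [|phi S IH] //=.
rewrite big_cons /vars_stages /= size_cat -/(vars_stages S).
by have := size_vars_formula phi; lia.
Qed.

Lemma used_mem I (i : 'I_(tau I)) (c : clause (nvars I)) (l : literal (nvars I)) :
  c \in tnth (stages I) i -> l \in (c : seq _) -> l.1 \in used I.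
Proof.
move=> ci lc; rewrite mem_fdup.
apply: (@vars_formula_sub _ (tnth (stages I) i)); first exact: mem_tnth.
by apply: vars_clause_sub ci _ _; apply: map_f.
Qed.

Lemma used_nil_clause I (i : 'I_(tau I)) (c : clause (nvars I)) :
  used I = [::] -> c \in tnth (stages I) i -> c = [bseq].
Proof.
move=> U0 ci; apply: val_inj => /=; case E: (val c) => [|l r] //.
have := @used_mem I i c l ci; rewrite E mem_head U0 => /(_ isT).
by rewrite in_nil.
Qed.

Lemma sat_fdup n (f : assignment n) (phi : formula n) :
  sat_formula f (fdup phi) = sat_formula f phi.
Proof. by apply: eq_all_r => c; rewrite mem_fdup. Qed.

(** Agreement is required only on occurring literals, so [g] may be arbitrary on all other
    variables. *)
Lemma sat_rename n n' (g : 'I_n -> 'I_n') (f : assignment n) (f' : assignment n')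
    (phi : formula n) :
  (forall (c : clause n) (l : literal n),
     c \in phi -> l \in (c : seq _) -> f' (g l.1) = f l.1) ->
  sat_formula f' [seq rename g c | c <- phi] = sat_formula f phi.
Proof.
move=> H; rewrite /sat_formula all_map; apply: eq_in_all => c cphi /=.
rewrite /sat_clause /= has_map; apply: eq_in_has => l lc /=.
by rewrite (H c l).
Qed.

(** * Equivalence of the kernel with the input *)

Lemma kernel_equiv I : solvable (kernel I) <-> solvable I.
Proof.
rewrite /kernel; case E: (used I) => [|x0 U0].
  have [S0|S0] := posnP (size (flatten (stages I))).
    (* Without clauses, constant assignments solve both instances. *)
    have nil_stage (i : 'I_(tau I)) : tnth (stages I) i = [::].
      case Ei: (tnth (stages I) i) => [|c r] //.
      have : c \in flatten (stages I).
        by apply/flattenP; exists (tnth (stages I) i);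
          rewrite ?mem_tnth // Ei mem_head.
      by rewrite (size0nil S0).
    split=> _.
      exists (fun=> [ffun=> false]); split=> [i|i j _]; first by rewrite nil_stage.
      by rewrite eq_card0 // => x; rewrite inE eqxx.
    exists (fun=> [ffun=> false]); split=> [i|i j _].
      by rewrite (tnth_nth [::]) ord1.
    by rewrite eq_card0 // => x; rewrite inE eqxx.
  (* Here some clause exists and is empty, so neither instance is solvable. *)
  split.
    by case=> f [] /(_ ord0).
  case=> f [Hf _]; move: S0; rewrite -has_predT => /hasP[c cS _].
  have [phi /tnthP[i ->] ci] := flattenP cS.
  by have /allP/(_ c ci) := Hf i; rewrite (used_nil_clause E ci).
rewrite -E; have U_gt0 : 0 < size (used I) by rewrite E.
have U_uniq : uniq (used I) := fdup_uniq _.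
have indexK x : x \in used I ->
    nat_of_ord (inord (index x (used I)) : 'I_(size (used I)).-1.+1)
      = index x (used I).
  by move=> xU; rewrite inordK // prednK // index_mem.
split=> [] [f [/= fsat fdist]].
  exists (fun i => [ffun x => (x \in used I) && f i (inord (index x (used I)))]).
  split=> [i|i j ij].
    set fi := finfun _.
    have := fsat i; rewrite tnth_map (@sat_rename _ _ _ fi) ?sat_fdup //.
    by move=> c l; rewrite mem_fdup ffunE => ci lc; rewrite (used_mem ci lc).
  apply: leq_trans (fdist i j ij).
  set D := (X in #|X| <= _).
  have DU x : x \in D -> x \in used I.
    by rewrite inE !ffunE; case: (x \in used I).
  (* Renaming is injective on used variables and maps each changed one to a changed kernel
     variable. *)
  rewrite -(@card_in_imset _ _
    (fun x => inord (index x (used I)) : 'I_(size (used I)).-1.+1) (mem D)).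
    apply: subset_leq_card; apply/subsetP => _ /imsetP[x xD ->].
    by move: (xD); rewrite !inE !ffunE (DU _ xD).
  move=> x y /DU xU /DU yU /(congr1 val) /=.
  by rewrite !indexK //; exact: index_inj.
(* Kernel variable [y] takes the value of the [y]-th used variable; the default [x0] is never
   reached. *)
exists (fun i => [ffun y : 'I__ => f i (nth x0 (used I) y)]); split=> [i|i j ij].
  rewrite tnth_map (@sat_rename _ _ _ (f i)) ?sat_fdup //.
  move=> c l; rewrite mem_fdup ffunE => ci lc.
  by rewrite indexK ?nth_index // (used_mem ci lc).
apply: leq_trans (fdist i j ij).
rewrite -(@card_in_imset _ _ (fun y : 'I_(size (used I)).-1.+1 => nth x0 (used I) y)).
  apply: subset_leq_card; apply/subsetP => _ /imsetP[y yD ->].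
  by move: yD; rewrite !inE !ffunE.
move=> y z _ _ /eqP; rewrite nth_uniq //; first by move/eqP; exact: val_inj.
  by rewrite -[X in _ < X]prednK.
by rewrite -[X in _ < X]prednK.
Qed.

(** * Size bounds *)

Lemma size_fdup_formula n (phi : formula n) : size (fdup phi) <= (n + n + 1) ^ 2.
Proof.
rewrite -(size_map (fun c : clause n => code c)) -[X in _ <= X](size_iota 0).
(* Codes send distinct clauses to distinct numbers below (2n+1)^2. *)
apply: uniq_leq_size.
  by rewrite map_inj_in_uniq ?fdup_uniq // => c c' _ _; apply: code_inj.
by move=> _ /mapP[c _ ->]; rewrite mem_iota /= code_bound.
Qed.

Lemma size_used I : size (used I) <= nvars I.
Proof.
rewrite -[X in _ <= X]card_ord -(card_uniqP (fdup_uniq _)); exact: max_card.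
Qed.

Lemma sum_clauses I :
  \sum_(i < tau I) size (tnth (stages I) i) = \sum_(phi <- stages I) size phi.
Proof. by rewrite big_tuple. Qed.

Lemma sum_clauses_le I :
  \sum_(i < tau I) size (tnth (stages I) i) <= max_clauses I * tau I.
Proof.
rewrite -[X in _ * X]card_ord mulnC -sum_nat_const; apply: leq_sum => i _.
exact: (@leq_bigmax _ (fun i : 'I_(tau I) => size (tnth (stages I) i))).
Qed.

Lemma kernel_size_nvars :
  kernelization_of_size nvars (fun n t => n ^ 2 * t) kernel.
Proof.
split; first exact: kernel_equiv.
exists 20 => I; have := size_used I; rewrite /kernel; case E: (used I) => [|x0 U0].
  move=> _; rewrite /inst_size /= big_ord1 (tnth_nth [::]) /= size_nseq.
  by case: (0 < _); lia.
rewrite -E => leU; rewrite /inst_size /=.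
(* With n >= 1 the total is at most 2n + 2 tau + tau (2n+1)^2 <= 13 n^2 tau. *)
have n_gt0 : 0 < nvars I by apply: leq_trans leU; rewrite E.
set s := (X in _ + X + _); have : s <= tau I * (nvars I + nvars I + 1) ^ 2.
  rewrite -[X in X * _]card_ord -sum_nat_const; apply: leq_sum => i _.
  by rewrite tnth_map size_map size_fdup_formula.
have := tau_gt0 I; rewrite !expnS expn0 !muln1; nia.
Qed.

Lemma kernel_size_clauses :
  kernelization_of_size max_clauses (fun m t => m * t) kernel.
Proof.
split; first exact: kernel_equiv.
exists 20 => I; rewrite /kernel; case E: (used I) => [|x0 U0].
  rewrite /inst_size /max_clauses /= !big_ord1 (tnth_nth [::]) /= size_nseq.
  by case: (0 < _); lia.
rewrite -E; have leU : size (used I) <= 2 * (max_clauses I * tau I).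
  apply: leq_trans (size_fdup _) _; apply: leq_trans (size_vars_stages _) _.
  by rewrite leq_mul2l -sum_clauses sum_clauses_le.
have U_gt0 : 0 < size (used I) by rewrite E.
(* With m >= 1 both m and tau are at most m tau, so the total is at most 6 m tau. *)
have m_gt0 : 0 < max_clauses I by move: U_gt0 leU; case: (max_clauses I) => //=; lia.
rewrite /inst_size /=.
set s := (X in _ + X + _); have les : s <= max_clauses I * tau I.
  apply: leq_trans (sum_clauses_le I); apply: leq_sum => i _.
  by rewrite tnth_map size_map size_fdup.
set m := (X in _ + (X + _)); have lem : m <= max_clauses I.
  apply/bigmax_leqP => i _; rewrite tnth_map size_map.
  apply: leq_trans (size_fdup _) _.
  exact: (@leq_bigmax _ (fun i : 'I_(tau I) => size (tnth (stages I) i))).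
have := tau_gt0 I; nia.
Qed.

(** * The program *)

(** [NAME], [MUL] and [MARK] are tables; from [IP] on, all other banks are scalars. [IP] and [OP]
    are the cursors, [HEAD] is the output address of the current clause count, and [CUT] is where an
    erasure stops. *)
Notation INP := 0 (only parsing).
Notation OUT := 1 (only parsing).
Notation IP := 2 (only parsing).
Notation OP := 3 (only parsing).
Notation STAGES := 4 (only parsing).
Notation CLAUSES := 5 (only parsing).
Notation LITS := 6 (only parsing).
Notation CODE := 7 (only parsing).
Notation COUNT := 8 (only parsing).
Notation STAMP := 9 (only parsing).
Notation HEAD := 10 (only parsing).
Notation CUT := 11 (only parsing).
Notation TOTAL := 12 (only parsing).
Notation NAME := 13 (only parsing).
Notation MUL := 14 (only parsing).
Notation MARK := 15 (only parsing).
Notation BASE := 16 (only parsing).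

Definition var (b : nat) : expr := Read b (Const 0).
Definition set (b : nat) (e : expr) : prog := Write b (Const 0) e.
Definition incr (b k : nat) : prog := set b (Add (var b) (Const k)).
Definition decr (b : nat) : prog := set b (Defs.Sub (var b) (Const 1)).
Definition input (k : nat) : expr := Read INP (Add (var IP) (Const k)).
Definition seqs (ps : seq prog) (p : prog) : prog := foldr Seq p ps.

(* The output beyond [OP] must stay zero, so a rejected clause is erased. *)
Definition truncate_out : prog :=
  While (Defs.Sub (var OP) (var CUT)) (Seq (decr OP) (Write OUT (var OP) (Const 0))).

Definition name_var : prog :=
  If (Read NAME (input 0)) Skip
    (Seq (incr COUNT 1) (Write NAME (input 0) (var COUNT))).

(** One Horner step on the code, with [MUL] in place of multiplication. The renamed literal is
    written before it is known whether its clause will be kept. *)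
Definition do_literal : prog :=
  seqs [:: set CODE (Add (Add (Read MUL (var CODE))
                              (Add (Add (input 0) (input 0)) (input 1))) (Const 1));
           name_var;
           Write OUT (var OP) (Defs.Sub (Read NAME (input 0)) (Const 1));
           Write OUT (Add (var OP) (Const 1)) (input 1);
           incr OP 2;
           incr IP 2] (decr LITS).

(** Marks never exceed the stamp, so the truncated difference is nonzero exactly for a clause new in
    this stage. *)
Definition close_clause : prog :=
  If (Defs.Sub (var STAMP) (Read MARK (var CODE)))
    (Seq (Write MARK (var CODE) (var STAMP))
         (Write OUT (var HEAD) (Add (Read OUT (var HEAD)) (Const 1))))
    truncate_out.

Definition do_clause : prog :=
  seqs [:: set CUT (var OP);
           set LITS (input 0);
           Write OUT (var OP) (input 0);
           incr OP 1;
           incr IP 1;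
           set CODE (Const 0);
           While (var LITS) do_literal;
           close_clause;
           incr TOTAL 1] (decr CLAUSES).

Definition do_stage : prog :=
  seqs [:: incr STAMP 1;
           set HEAD (var OP);
           set CLAUSES (input 0);
           incr OP 1;
           incr IP 1;
           While (var CLAUSES) do_clause] (decr STAGES).

Definition init_mul : prog :=
  seqs [:: set BASE (Add (Add (input 0) (input 0)) (Const 1));
           set LITS (var BASE);
           set CODE (Const 0)]
    (While (var LITS)
      (seqs [:: Write MUL (Add (var CODE) (Const 1))
                          (Add (Read MUL (var CODE)) (var BASE));
                incr CODE 1] (decr LITS))).

(** The number of names is known only now. If it is zero, all stages are erased and a single one is
    written; the length 0 of its possible empty clause is already in memory as padding. *)
Definition finish : prog :=
  If (var COUNT)
    (Seq (Write OUT (Const 0) (var COUNT)) (Write OUT (Const 1) (Read INP (Const 1))))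
    (seqs [:: set CUT (Const 3); truncate_out; Write OUT (Const 1) (Const 1)]
       (If (var TOTAL) (Write OUT (Const 3) (Const 1)) Skip)).

Definition kernel_prog : prog :=
  seqs [:: init_mul;
           Write OUT (Const 2) (Read INP (Const 2));
           set OP (Const 3);
           set IP (Const 3);
           set STAGES (Read INP (Const 1));
           While (var STAGES) do_stage] finish.

(** * Reading, writing and erasing *)

Definition reading (s : memory) (w : seq nat) :=
  forall a, s INP (s IP 0 + a) = nth 0 w a.

(** The default 0 of [nth] expresses the zero padding behind the output. *)
Definition written (s : memory) (w : seq nat) :=
  s OP 0 = size w /\ forall a, s OUT a = nth 0 w a.

Definition mul_table (n : nat) (s : memory) :=
  forall k, k <= n + n -> s MUL k = k * (n + n + 1).

Lemma reading_head s x w : reading s (x :: w) -> s INP (s IP 0) = x.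
Proof. by move=> H; rewrite -[X in s INP X]addn0 H. Qed.

Lemma nth_append (w : seq nat) v a :
  (if a == size w then v else nth 0 w a) = nth 0 (rcons w v) a.
Proof.
rewrite nth_rcons; case: (ltngtP a (size w)) => // lt.
by rewrite nth_default // ltnW.
Qed.

Lemma nth_bump (w1 : seq nat) k w2 a v :
  (if a == size w1 then v else nth 0 (w1 ++ k :: w2) a) = nth 0 (w1 ++ v :: w2) a.
Proof.
rewrite !nth_cat; case: (ltngtP a (size w1)) => [||->] //; last by rewrite subnn.
case E: (a - size w1) => [|j] //; move/eqP: E.
by rewrite subn_eq0 => /leq_ltn_trans H /H; rewrite ltnn.
Qed.

Lemma hoare_truncate s w p : written s w -> s CUT 0 = p -> p <= size w ->
  hoare truncate_out s ((size w - p) * 3).+1 (fun s' => written s' (take p w)).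
Proof.
move=> [Hop Hout] Hcut lepw.
pose I (d r : seq nat) (s : memory) :=
  [/\ s CUT 0 = p, p + size r <= size w, s OP 0 = p + size r &
      forall a, s OUT a = nth 0 (take (p + size r) w) a].
have := @hoare_while _ (Defs.Sub (var OP) (var CUT))
  (Seq (decr OP) (Write OUT (var OP) (Const 0))) (fun=> 2) I _ _
  (* Only the length of this list matters: one entry per cell to erase. *)
  (nseq (size w - p) 0) [::] s.
rewrite big_const_seq count_predT size_nseq iter_addn_0 mulnC => H.
apply: hoare_weaken (H _ _ _) _ _ => //.
- move=> d x r s0 [/= h1 h2 h3 h4]; split; first by rewrite h1 h3; lia.
  apply: hoare_write_seq; apply: hoare_write => //=.
  split=> //=; rewrite ?h3; try lia.
  move=> a; rewrite h4; case: eqP => [->|ne].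
    by rewrite nth_default // size_take; case: ltnP; lia.
  have [lt|ge] := ltnP a (p + size r).
    by rewrite !nth_take //; lia.
  by rewrite !nth_default // size_take; case: ltnP; lia.
- by move=> d s0 [/= h1 h2 h3 h4]; rewrite h1 h3; lia.
- split=> //; rewrite ?size_nseq ?subnKC // => a.
  by rewrite take_size.
by move=> s' [/= h1 h2 h3 h4]; split=> [|a]; rewrite ?h3 ?h4 addn0 // size_takel.
Qed.

Lemma hoare_seqf p q s T1 T2 Q1 Q :
  hoare p s T1 Q1 ->
  (forall s', Q1 s' -> (forall b, b \notin writes p -> s' b =1 s b) ->
    hoare q s' T2 Q) ->
  hoare (Seq p q) s (T1 + T2) Q.
Proof.
move=> H1 H2; apply: (@hoare_seq _ _ _ _ _
  (fun s' => Q1 s' /\ forall b, b \notin writes p -> s' b =1 s b)).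
  by apply: hoare_frame; apply: hoare_weaken H1 _ _ => // s' Q1s' F; exact: conj Q1s' F.
by move=> s' [Q1s' F]; exact: H2.
Qed.

(** * Correctness and cost of the pass over the stages *)

Section Passes.
Variables (n : nat) (L : seq 'I_n).
Local Notation U := (fdup L).

(* Names are indices in the final list [U], of which [fdup done] is a prefix,
   shifted by one so that [0] means unnamed. *)
Definition named (s : memory) (done : seq 'I_n) :=
  s COUNT 0 = size (fdup done) /\
  forall x : 'I_n, s NAME x = if x \in done then (index x U).+1 else 0.

Lemma hoare_name_var s done (x : 'I_n) rest w :
  L = done ++ x :: rest -> named s done -> reading s (val x :: w) ->
  hoare name_var s 3 (fun s' => named s' (rcons done x)).
Proof.
move=> EL [Hc Hn] Hr; have Hx := reading_head Hr.
apply: hoare_if => /=; rewrite addn0 Hx Hn; case: ifP => // xd _.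
  apply: hoare_skip => //; split; first by rewrite fdup_rcons xd.
  by move=> y; rewrite Hn mem_rcons inE; case: eqP => [->|]; rewrite ?xd.
apply: hoare_write_seq; apply: hoare_write => //=.
rewrite addn0 Hx; split=> /= [|y]; first by rewrite fdup_rcons xd size_rcons Hc addn1.
rewrite Hn mem_rcons inE val_eqE; case: eqP => [->|] //=.
by rewrite EL index_fdup ?xd // Hc addn1.
Qed.

Definition enc_literal (l : literal n) : seq nat := [:: val l.1; nat_of_bool l.2].
Definition out_literal (l : literal n) : seq nat := [:: index l.1 U; nat_of_bool l.2].
Definition out_clause (c : clause n) : seq nat :=
  size c :: flatten [seq out_literal l | l : literal n <- c].
Definition out_formula (phi : formula n) : seq nat :=
  size phi :: flatten [seq out_clause c | c : clause n <- phi].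

(** At most two iterations of 9 steps and a test each, plus the final test, make 21. *)
Lemma hoare_literals s (c : seq (literal n)) done rest w A :
  size c <= 2 -> L = done ++ vars_clause c ++ rest -> named s done ->
  s LITS 0 = size c -> s CODE 0 = 0 -> mul_table n s ->
  reading s (flatten [seq enc_literal l | l <- c] ++ w) -> written s A ->
  hoare (While (var LITS) do_literal) s 21
    (fun s' => [/\ reading s' w, written s' (A ++ flatten [seq out_literal l | l <- c]),
                   s' CODE 0 = code c & named s' (done ++ vars_clause c)]).
Proof.
move=> c2 EL Hn Hl Hc Hm Hr Hw.
pose I (d r : seq (literal n)) (s : memory) :=
  d ++ r = c /\
  [/\ s LITS 0 = size r, s CODE 0 = code d & mul_table n s] /\
  [/\ reading s (flatten [seq enc_literal l | l <- r] ++ w),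
      written s (A ++ flatten [seq out_literal l | l <- d])
    & named s (done ++ vars_clause d)].
have := @hoare_while _ (var LITS) do_literal (fun=> 9) I _ _ c [::] s.
rewrite big_const_seq count_predT iter_addn_0 => H.
apply: hoare_weaken (H _ _ _) _ _ => //; last 1 first.
- by move=> s' /= [_ [[_ h1 _] [h2 h3 h4]]].
- move=> d l r {Hn Hl Hc Hm Hr Hw H}s [Edr [[Hl Hc Hm] [Hr Hw Hn]]].
  split; first by rewrite /= Hl.
  (* At most one literal precedes [l], so the old code is at most one digit and lies in the
     table. *)
  have code_d : code d <= n + n.
    move: c2; rewrite -Edr size_cat /= addnS => c2.
    case: d {Edr Hc Hw Hn} c2 => [|l0 [|? ?]] //= _.
    by have := digit_bound l0; rewrite /code /= mul0n add0n addn1 ltnS.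
  have Hr0 := reading_head Hr.
  have Hr1 : s INP (s IP 0 + 1) = l.2 by rewrite Hr.
  apply: hoare_write_seq => /=; rewrite addn0 Hr0 Hr1 Hc Hm //.
  apply: (@hoare_seqf _ _ _ 3 5); first
    apply: (@hoare_name_var _ (done ++ vars_clause d) l.1 (vars_clause r ++ rest)).
  - by rewrite EL -Edr /vars_clause map_cat -!catA.
  - exact: Hn.
  - exact: Hr.
  move=> s' Hn' F.
  have FI := F INP isT; have FO := F OUT isT; have FP := F IP isT.
  have FQ := F OP isT; have FL := F LITS isT; have FC := F CODE isT.
  have FM := F MUL isT.
  have {}Hr a : s' INP (s' IP 0 + a) =
      nth 0 (enc_literal l ++ flatten [seq enc_literal l | l <- r] ++ w) a.
    by rewrite FI FP /= Hr.
  have Hx : s' INP (s' IP 0) = val l.1 by rewrite -[X in s' INP X]addn0 Hr.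
  do 4 apply: hoare_write_seq; apply: hoare_write => //=.
  rewrite addn0 Hx Hr /= (Hn'.2 l.1) mem_rcons mem_head subn1 /= FQ /=.
  split; first by rewrite cat_rcons.
  split; split=> /=.
  - by rewrite FL /= Hl subn1.
  - by rewrite FC /= /code -cats1 foldl_cat /= /digit [LHS]addn1 [RHS]addnS.
  - by move=> k lek; rewrite /= FM /= Hm.
  - by move=> a; rewrite /= -addnA Hr.
  - rewrite map_rcons flatten_rcons catA; split=> /=.
      by rewrite Hw.1 !size_cat /=; lia.
    move=> a; rewrite Hw.1 FO /= Hw.2.
    by rewrite -cat_rcons cats1 -!nth_append size_rcons addn1.
  - by rewrite /vars_clause map_rcons -rcons_cat.
- by move=> d s0 [_ [[h _ _] _]].
- by split=> //; split; split=> //=; rewrite cats0.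
- by lia.
Qed.

(** The first condition makes every mark outdated once the stamp is raised. *)
Definition marked (s : memory) (phi : formula n) :=
  (forall a, s MARK a <= s STAMP 0) /\
  forall c : clause n, (s MARK (code c) == s STAMP 0) = (c \in phi).

Lemma size_out_clause (c : clause n) : size (out_clause c) <= 5.
Proof. by case: c => [[|l [|l' []]]]. Qed.

(** Rejection is the costly branch: at most five cells at 3 steps each, the final loop test and the
    branching make 17. *)
Lemma hoare_close_clause s (c : clause n) (phi : formula n) A :
  marked s phi -> s CODE 0 = code c -> s HEAD 0 = size A ->
  s CUT 0 = size (A ++ out_formula (fdup phi)) ->
  written s (A ++ out_formula (fdup phi) ++ out_clause c) ->
  hoare close_clause s 17
    (fun s' => written s' (A ++ out_formula (fdup (rcons phi c))) /\
               marked s' (rcons phi c)).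
Proof.
move=> [Hle Hm] Hcode Hh Hcut Hw.
apply: hoare_if => /=; rewrite Hcode => Hs.
  have cphi : c \notin phi by rewrite -Hm; apply: contra Hs => /eqP ->; rewrite subnn.
  apply: hoare_write_seq; apply: hoare_write => //=; rewrite Hcode Hh.
  split.
    rewrite fdup_rcons (negbTE cphi) /out_formula map_rcons flatten_rcons size_rcons.
    split=> /=; first by rewrite Hw.1 !size_cat /= size_cat addSn.
    move=> a; rewrite Hw.2 nth_cat ltnn subnn /= addn1 Hw.2.
    by rewrite /out_formula /= nth_bump.
  split=> /= [a|c']; first by case: ifP.
  (* By injectivity of codes, no other clause shares the cell just marked. *)
  rewrite mem_rcons inE -Hm; case: (eqVneq (code c') (code c)) => [H|].
    by rewrite (code_inj H) !eqxx.
  by case: (c' =P c) => [->|]; rewrite ?eqxx.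
have cphi : c \in phi by rewrite -Hm eqn_leq Hle /=; lia.
have lecut : s CUT 0 <= size (A ++ out_formula (fdup phi) ++ out_clause c).
  by rewrite Hcut !size_cat; lia.
apply: hoare_frame; apply: hoare_weaken (hoare_truncate Hw erefl lecut) _ _.
  by rewrite Hcut !size_cat; have := size_out_clause c; lia.
move=> s' Hw' F; rewrite Hcut catA take_size_cat // in Hw'.
rewrite fdup_rcons cphi; split=> //; split=> [a|c'].
  by rewrite !(F MARK, F STAMP).
by rewrite !(F MARK, F STAMP) // Hm mem_rcons inE; case: eqP => [->|].
Qed.

(** State inside a stage: [A], [total] and [done] are the output, clause count and variable
    occurrences of what came before the stage, and [w] is the input after it. *)
Definition clause_inv (A : seq nat) (total : nat) (done : seq 'I_n) (w : seq nat)
    (d r : formula n) (s : memory) :=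
  [/\ s CLAUSES 0 = size r, s HEAD 0 = size A, s TOTAL 0 = total + size d,
      mul_table n s & marked s d] /\
  [/\ reading s (flatten [seq encode_clause c | c : clause n <- r] ++ w),
      written s (A ++ out_formula (fdup d)) & named s (done ++ vars_formula d)].

(** The cost splits as 6 + 21 + 17 + 2: set-up, literals, closing, counters. *)
Lemma hoare_clause A total done w rest (d r : formula n) (c : clause n) s :
  L = done ++ vars_formula (d ++ c :: r) ++ rest ->
  clause_inv A total done w d (c :: r) s ->
  hoare do_clause s 46 (clause_inv A total done w (rcons d c) r).
Proof.
move=> EL [[Hc Hh Ht Hm Hk] [Hr Hw Hn]].
have Hr0 := reading_head Hr.
set W := A ++ _ in Hw.
do 6 apply: hoare_write_seq => /=; rewrite !addn0 Hr0.
apply: (@hoare_seqf _ _ _ 21 19).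
  apply: (@hoare_literals _ c (done ++ vars_formula d) (vars_formula r ++ rest)
    (flatten [seq encode_clause c | c : clause n <- r] ++ w) (rcons W (size c))) => //.
  - exact: size_bseq.
  - by rewrite EL /vars_formula map_cat flatten_cat /= -!catA.
  - by move=> a; rewrite /= -addnA Hr /= -catA.
  - split=> /=; first by rewrite Hw.1 size_rcons addn1.
    by move=> a; rewrite Hw.1 Hw.2 nth_append.
move=> s1 [Hr1 Hw1 Hc1 Hn1] F1.
apply: (@hoare_seqf _ _ _ 17 2).
  apply: (@hoare_close_clause _ c d A) => //.
  - by split=> [a|c']; rewrite !(F1 MARK, F1 STAMP) //=; [exact: Hk.1|exact: Hk.2].
  - by rewrite F1.
  - by rewrite F1 //= Hw.1.
  - by move: Hw1; rewrite cat_rcons /W -catA.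
move=> s2 [Hw2 Hk2] F2.
apply: hoare_write_seq; apply: hoare_write => //=.
split; split=> //=.
- by rewrite F2 // F1 //= Hc subn1.
- by rewrite F2 // F1.
- by rewrite F2 // F1 //= Ht size_rcons addn1 addnS.
- by move=> k lek; rewrite /= F2 // F1 //= Hm.
- by move=> a; rewrite /= !F2 // Hr1.
- split=> [|x]; rewrite /= F2 //.
    by rewrite Hn1.1 /vars_formula map_rcons flatten_rcons catA.
  by rewrite Hn1.2 /vars_formula map_rcons flatten_rcons catA.
Qed.

Lemma hoare_clauses A total done w rest (phi : formula n) s :
  L = done ++ vars_formula phi ++ rest ->
  clause_inv A total done w [::] phi s ->
  hoare (While (var CLAUSES) do_clause) s (47 * size phi).+1
    (clause_inv A total done w phi [::]).
Proof.
move=> EL Hs; pose I d r s := d ++ r = phi /\ clause_inv A total done w d r s.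
have := @hoare_while _ (var CLAUSES) do_clause (fun=> 46) I _ _ phi [::] s.
rewrite big_const_seq count_predT iter_addn_0 => H.
apply: hoare_weaken (H _ _ _) _ _ => // [d c r s0 [Edr Inv]|d s0 [_ [[]]]|s' []] //.
split; first by case: Inv => [[/= ->]].
rewrite -Edr in EL; apply: hoare_weaken (hoare_clause EL Inv) _ _ => // s' Inv'.
by split=> //; rewrite cat_rcons.
Qed.

Definition stage_inv (hd : seq nat) (D E : seq (formula n)) (s : memory) :=
  [/\ s STAGES 0 = size E, s TOTAL 0 = size (flatten D), mul_table n s &
      forall a, s MARK a <= s STAMP 0] /\
  [/\ reading s (flatten [seq encode_formula phi | phi <- E]),
      written s (hd ++ flatten [seq out_formula (fdup phi) | phi <- D])
    & named s (vars_stages D)].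

Lemma hoare_stage hd (D E : seq (formula n)) (phi : formula n) s :
  L = vars_stages (D ++ phi :: E) -> stage_inv hd D (phi :: E) s ->
  hoare do_stage s (47 * size phi + 7) (stage_inv hd (rcons D phi) E).
Proof.
move=> EL [[Hs Ht Hm Hk] [Hr Hw Hn]].
have Hr0 := reading_head Hr.
set A := hd ++ _ in Hw.
have -> : 47 * size phi + 7 = ((47 * size phi).+1 + 1).+1.+4 by lia.
do 5 apply: hoare_write_seq => /=; rewrite !addn0 Hr0.
apply: hoare_seqf.
  apply: (@hoare_clauses A (size (flatten D)) (vars_stages D)
    (flatten [seq encode_formula phi | phi <- E]) (vars_stages E) phi).
    by rewrite EL /vars_stages map_cat flatten_cat.
  split; split=> //=.
  - by rewrite Hw.1.
  - by rewrite addn0.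
  (* All old marks are now strictly below the stamp, so no clause counts as seen. *)
  - split=> /= [a|c]; first by have := Hk a; lia.
    by rewrite in_nil; have := Hk (code c); lia.
  - by move=> a; rewrite /= -addnA Hr.
  (* The count cell is skipped, not written: its padding zero is the count of the empty list. *)
  - split=> /=; first by rewrite size_cat Hw.1.
    by move=> a; rewrite Hw.2 cats1 -nth_append; case: eqP => // ->; rewrite nth_default.
  - by rewrite cats0.
move=> s1 [[_ _ Ht1 Hm1 Hk1] [Hr1 Hw1 Hn1]] F1.
apply: hoare_write => //=; split; split=> //=.
- by rewrite F1 //= Hs subn1.
- by rewrite Ht1 -cats1 flatten_cat size_cat /= cats0.
- exact: Hk1.1.
- by move: Hw1; rewrite map_rcons flatten_rcons catA.
- by rewrite /vars_stages map_rcons flatten_rcons.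
Qed.

Lemma hoare_stages hd (S : seq (formula n)) s :
  L = vars_stages S -> stage_inv hd [::] S s ->
  hoare (While (var STAGES) do_stage) s
    (\sum_(phi <- S) (47 * size phi + 7).+1).+1 (stage_inv hd S [::]).
Proof.
move=> EL Hs; pose I D E s := D ++ E = S /\ stage_inv hd D E s.
have := @hoare_while _ (var STAGES) do_stage (fun phi => 47 * size phi + 7)
  I _ _ S [::] s.
move=> H; apply: hoare_weaken (H _ _ _) _ _ => //
  [D phi E s0 [EDE Inv]|D s0 [_ [[]]]|s' []] //.
split; first by case: Inv => [[/= ->]].
rewrite -EDE in EL; apply: hoare_weaken (hoare_stage EL Inv) _ _ => // s' Inv'.
by split=> //; rewrite cat_rcons.
Qed.

(** Keeps linear the cost of erasing the whole output in [finish]. *)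
Lemma size_out_stages (S : seq (formula n)) :
  size (flatten [seq out_formula (fdup phi) | phi <- S]) <=
    size S + 5 * \sum_(phi <- S) size phi.
Proof.
elim: S => [|phi S IH] /=; first by rewrite big_nil.
have H : size (out_formula (fdup phi)) <= (5 * size phi).+1.
  rewrite ltnS; apply: (@leq_trans (5 * size (fdup phi)));
    last by rewrite leq_mul2l size_fdup.
  elim: (fdup phi) => [|c r IHr] //.
  rewrite [size (c :: r)]/= mulnS.
  by apply: leq_trans (leq_add (size_out_clause c) IHr); rewrite -size_cat.
by rewrite big_cons size_cat; apply: leq_trans (leq_add H IH) _; lia.
Qed.

End Passes.

(** * Multiplication table, final output and total running time *)

Lemma hoare_init_mul n s :
  s INP 0 = n -> s IP 0 = 0 -> s MUL 0 = 0 ->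
  hoare init_mul s (8 * n + 8) (mul_table n).
Proof.
move=> Hn Hip Hm; rewrite -[8 * n + 8]/(8 * n + (5 + 3)) addnA addnC.
do 3 apply: hoare_write_seq => /=; rewrite !addn0 Hip Hn.
set s1 := update _ _ _ _.
pose I (d r : seq nat) (s : memory) :=
  [/\ s LITS 0 = size r, s CODE 0 = size d, s BASE 0 = n + n + 1 &
      forall k, k <= size d -> s MUL k = k * (n + n + 1)].
have := @hoare_while _ (var LITS)
  (seqs [:: Write MUL (Add (var CODE) (Const 1))
                          (Add (Read MUL (var CODE)) (var BASE));
            incr CODE 1] (decr LITS)) (fun=> 3) I _ _ (nseq (n + n + 1) 0) [::] s1.
rewrite big_const_seq count_predT iter_addn_0 size_nseq => H.
apply: hoare_weaken (H _ _ _) _ _ => //; last 1 first.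
- by move=> s' [_ _ _ H'] k lek; rewrite H' // size_nseq; lia.
- move=> d x r s0 [h1 h2 h3 h4]; split; first by rewrite /= h1.
  do 2 apply: hoare_write_seq; apply: hoare_write => //=.
  split=> //=; first by rewrite h1 subn1.
    by rewrite h2 size_rcons addn1.
  rewrite size_rcons h2 => k lek; case: eqP => [->|ne]; first by rewrite h3 h4 //; lia.
  by apply: h4; lia.
- by move=> d s0 [].
- by split=> //= [|[]]; rewrite ?size_nseq.
- by lia.
Qed.

(** The variables of [c] are used, so [inord] keeps their indices and the encoding is what the pass
    writes. *)
Lemma encode_rename I (c : clause (nvars I)) i :
  c \in tnth (stages I) i ->
  encode_clause
    (rename (fun x => inord (index x (used I)) : 'I_(size (used I)).-1.+1) c)
    = out_clause (vars_stages (stages I)) c.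
Proof.
move=> ci; rewrite /encode_clause /out_clause /= size_map -map_comp.
congr (_ :: flatten _); apply/eq_in_map => l lc /=; rewrite /out_literal inordK // prednK.
  by rewrite index_mem (used_mem ci lc).
by have := used_mem ci lc; case: (used I).
Qed.

Lemma encode_kernel I : used I != [::] ->
  encode (kernel I) = [:: size (used I); tau I; dist I] ++
    flatten [seq out_formula (vars_stages (stages I)) (fdup phi) | phi <- stages I].
Proof.
rewrite /kernel; case E: (used I) => [|x0 U0] // _; rewrite -E /encode /=.
congr [:: _, _, _ & flatten _]; first by rewrite E.
rewrite -map_comp; apply/eq_in_map => phi /tnthP[i ->] /=.
rewrite /encode_formula /out_formula size_map -map_comp; congr (_ :: flatten _).
apply/eq_in_map => c; rewrite mem_fdup => ci /=; exact: encode_rename ci.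
Qed.

Lemma encode_kernel_nil I : used I = [::] ->
  encode (kernel I) = if size (flatten (stages I)) is 0 then [:: 0; 1; dist I; 0]
                      else [:: 0; 1; dist I; 1; 0].
Proof.
by move=> E; rewrite /kernel E /encode /=; case: (size (flatten (stages I))).
Qed.

Lemma hoare_finish I s :
  stage_inv (vars_stages (stages I)) [:: 0; 0; dist I] (stages I) [::] s ->
  s INP 1 = tau I ->
  hoare finish s (3 * (tau I + 5 * \sum_(phi <- stages I) size phi) + 6)
    (fun s' => forall a, s' OUT a = nth 0 (encode (kernel I)) a).
Proof.
move=> [[_ Ht _ _] [_ Hw Hn]] Htau.
have := size_out_stages (vars_stages (stages I)) (stages I).
rewrite size_tuple; set w := flatten _ in Hw * => lew.
rewrite addnS; apply: hoare_if => /=; rewrite Hn.1 -/(used I) => HU.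
  apply: (@hoare_weaken _ _ 2 _ _ _ _ _ (fun=> id)); last by lia.
  apply: hoare_write_seq; apply: hoare_write => //= a.
  rewrite encode_kernel; last by apply: contraNN HU => /eqP ->.
  by rewrite Htau Hn.1 Hw.2; case: a => [|[|a]].
have {}HU : used I = [::] by apply: size0nil.
apply: (@hoare_weaken _ _ ((size w * 3).+1 + 3).+1 _ _ _ _ _ (fun=> id)); last by lia.
apply: hoare_write_seq; apply: hoare_seqf.
  (* Erasure spares the three header cells. *)
  have -> : size w = size ([:: 0; 0; dist I] ++ w) - 3 by rewrite size_cat /= addKn.
  by apply: hoare_truncate => //; exact: Hw.
move=> s1 [_ Hw1] F.
apply: hoare_write_seq; rewrite encode_kernel_nil //.
apply: hoare_if => /=; rewrite F //= Ht => Hk.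
  apply: hoare_write => //= a; move: Hk; case: (size _) => // k _.
  by rewrite Hw1; case: a => [|[|[|[|[|a]]]]] //=; rewrite take0 ?nth_nil.
apply: hoare_skip => //= a; rewrite Hk Hw1.
by case: a => [|[|[|[|a]]]] //=; rewrite take0 ?nth_nil.
Qed.

Lemma kernel_linear_time : linear_time_computable kernel.
Proof.
exists kernel_prog, 100 => I; set s0 := input_memory _.
set T := 8 * nvars I + 8 + (((\sum_(phi <- stages I) (47 * size phi + 7).+1).+1 +
  (3 * (tau I + 5 * \sum_(phi <- stages I) size phi) + 6)).+4).
have leT : T <= 100 * inst_size I.
  rewrite /T /inst_size sum_clauses.
  have -> : \sum_(phi <- stages I) (47 * size phi + 7).+1 =
      47 * \sum_(phi <- stages I) size phi + 8 * tau I.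
    rewrite -[X in 8 * X](size_tuple (stages I)).
    elim: (val (stages I)) => [|phi S IH]; first by rewrite !big_nil.
    by rewrite !big_cons IH /=; lia.
  (* The additive constants are absorbed because tau >= 1. *)
  by have := tau_gt0 I; lia.
suff [t [s' [H1 H2 H3]]] : hoare kernel_prog s0 T
    (fun s' => forall a, s' OUT a = nth 0 (encode (kernel I)) a).
  by exists t, s'; split=> //; apply: leq_trans leT.
apply: hoare_seqf; first exact: (@hoare_init_mul (nvars I)).
move=> s1 Hm F.
do 4 apply: hoare_write_seq => /=; rewrite !(F INP) //=.
apply: hoare_seqf.
  apply: (@hoare_stages _ (vars_stages (stages I)) [:: 0; 0; dist I] (stages I)) => //.
  split; split=> //=.
  - by rewrite size_tuple.
  - by rewrite F.
  - by move=> a; rewrite !F.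
  - by move=> a; rewrite /= F.
  - by split=> //= a; rewrite F //; case: a => [|[|[|a]]] //=; rewrite nth_nil.
  - by split=> [|x]; rewrite /= F.
move=> s2 Hs2 F2; apply: hoare_finish => //.
by rewrite F2 //= F.
Qed.

Theorem theorem7p4 :
  (exists K : instance -> instance,
      linear_time_computable K /\
      kernelization_of_size nvars (fun n t => n ^ 2 * t) K) /\
  (exists K : instance -> instance,
      linear_time_computable K /\
      kernelization_of_size max_clauses (fun m t => m * t) K).
Proof.
split; exists kernel; split; try exact: kernel_linear_time.
  exact: kernel_size_nvars.
exact: kernel_size_clauses.
Qed.
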